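(* Let $G$ be an extraspecial $2$-group of order $2^{2n+1}$ with center $Z=\{1,z\}$. Let $T$ be a partial $k$-spread in $\mathbb{F}_2^{2n}$ with $N$ elements, and assume that the points of $T$ span $\mathbb{F}_2^{2n}$. Let $X=\mathrm{Cay}(G,S)$ with $S=K(x_1)\cup\cdots\cup K(x_\ell)$ (a union of distinct conjugacy classes of noncentral elements, so $z\notin S$) such that the image $\bar S=\{\bar x_1,\dots,\bar x_\ell\}$ of $S$ in $G/Z\cong\mathbb{F}_2^{2n}$ is the set of points incident to the elements of $T$. If $\nu_2(N)\le k-1$, then $X$ is a connected graph which admits perfect state transfer with minimum time $\pi/2^{\nu_2(2N)}$. In particular, when $T$ is a partial $n$-spread for $n\ge2$ and $N=2^{n-1}$, then $X$ is a connected graph which admits perfect state transfer with minimum time $\pi/2^n$.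
   Context: An extraspecial $2$-group is a finite $2$-group $G$ whose center $Z$ has order $2$ and such that $G/Z\cong(\mathbb{Z}/2\mathbb{Z})^m$ for some $m\ge1$; its order is $2^{2n+1}$ for some $n\ge1$. Fix an isomorphism $G/Z\cong\mathbb{F}_2^{2n}$ and write $\bar g$ for the image of $g\in G$. The conjugacy class of a noncentral $x$ is $K(x)=\{x,xz\}$. A partial $k$-spread in $\mathbb{F}_2^{2n}$ is a set of $k$-dimensional subspaces any two of which intersect in the zero subspace. The points incident to the elements of $T$ (the points of $T$) are the nonzero vectors lying in some element of $T$. $\mathrm{Cay}(G,S)$ is the graph with vertex set $G$ in which $g,h$ are adjacent iff $gh^{-1}\in S$. For a graph with adjacency matrix $A$, $U_A(t)=\sum_{k\ge0}\frac{(it)^k}{k!}A^k$; the graph admits perfect state transfer at time $\tau>0$ if there are distinct vertices $u,v$ and $\lambda\in\mathbb{C}$ with $U_A(\tau)e_u=\lambda e_v$. The minimum time is the smallest $\tau>0$ at which perfect state transfer occurs. $\nu_2$ is the $2$-adic valuation. *)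

(* Defs.v *)
From HB Require Import structures.
From mathcomp Require Import all_boot all_order all_fingroup all_algebra.
From mathcomp Require Import all_solvable.
From mathcomp Require Import all_classical all_reals all_analysis.
From mathcomp Require Import complex.

Set Implicit Arguments.
Unset Strict Implicit.
Unset Printing Implicit Defensive.

Import Order.TTheory GRing.Theory Num.Theory GroupScope.
Import numFieldNormedType.Exports.

Local Open Scope ring_scope.

(* R[i] itself has no canonical topology; bundling it as a numClosedFieldType
   gives it, and the matrices over it, the topology of the complex modulus. *)
Definition CC (R : realType) : numClosedFieldType := R[i].

(* For 2-groups the library's [extraspecial] is the usual definition through
   the center and the central quotient. *)
Lemma extraspecial2P (gT : finGroupType) (G : {group gT}) :
  (2.-group G /\ extraspecial G) <->
  [/\ #|'Z(G)| = 2%N, 2.-abelem (G / 'Z(G)) & (G / 'Z(G) != 1)%g].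
Proof.
split=> [[pG esG]|[oZ abQ ntQ]].
  have [[defPhi defG'] _] := esG.
  have oZ := card_center_extraspecial pG esG; split=> //.
    by rewrite -defPhi Phi_quotient_abelem.
  rewrite -subG1 quotient_sub1 ?normal_norm ?center_normal //.
  rewrite finset.subsetI subxx /=.
  exact: extraspecial_nonabelian esG.
have pG : 2.-group G.
  rewrite /pgroup -(Lagrange (center_sub G)) pnatM oZ /=.
  rewrite -card_quotient ?normal_norm ?center_normal //.
  exact: abelem_pgroup abQ.
split=> //; split; last by rewrite oZ.
have sPhi : 'Phi(G) \subset 'Z(G).
  exact: Phi_min pG (normal_norm (center_normal G)) abQ.
have sG' : (G^`(1) \subset 'Phi(G))%g.
  by rewrite (Phi_joing pG) joing_subl.
have ntG' : (G^`(1) != 1)%g.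
  apply: contraNneq ntQ => /commG1P abG.
  rewrite -subG1 quotient_sub1 ?normal_norm ?center_normal //.
  by rewrite finset.subsetI subxx.
have defG' : G^`(1)%g = 'Z(G).
  apply/eqP; rewrite eqEcard (fintype.subset_trans sG' sPhi) oZ /=.
  by rewrite ltnNge -trivg_card_le1.
by split=> //; apply/eqP; rewrite finset.eqEsubset sPhi /= -{1}defG'.
Qed.

Definition connected_graph (V : finType) (e : rel V) : Prop :=
  [/\ symmetric e, irreflexive e & forall u v, connect e u v].

Definition cayley (gT : finGroupType) (G : {group gT}) (S : {set gT}) :
    rel (subg_of G) :=
  fun g h => (sgval g * (sgval h)^-1)%g \in S.

Section StateTransfer.
Variable R : realType.

Definition adjmx (V : finType) (e : rel V) : 'M[CC R]_#|V| :=
  \matrix_(i, j) (e (enum_val i) (enum_val j))%:R.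

Definition transition_mx (n : nat) (A : 'M[CC R]_n) (t : R) : 'M[CC R]_n :=
  limn (series (fun k =>
    (('i * (t%:C)%C) ^+ k / k`!%:R : CC R) *: A ^+ k)).

Definition perfect_state_transfer (V : finType) (e : rel V) (t : R) : Prop :=
  0 < t /\
  exists u v : 'I_#|V|, u != v /\ exists lambda : CC R,
    transition_mx (adjmx e) t *m delta_mx u (0 : 'I_1) =
    lambda *: delta_mx v (0 : 'I_1).

Definition pst_minimum_time (V : finType) (e : rel V) (t : R) : Prop :=
  perfect_state_transfer e t /\
  forall s, perfect_state_transfer e s -> t <= s.

End StateTransfer.

(* A finite set of subspaces is a duplicate-free sequence. *)
Definition partial_spread (F : fieldType) (V : vectType F) (k : nat)
    (T : seq {vspace V}) : Prop :=
  [/\ uniq T,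
      {in T, forall U, \dim U = k} &
      {in T &, forall U W, U != W -> (U :&: W)%VS = 0%VS}].

Definition spread_points (d : nat) (T : seq {vspace 'rV['F_2]_d}) :
    {set 'rV['F_2]_d} :=
  [set v : 'rV['F_2]_d | (v != 0) && has (fun U : {vspace _} => v \in U) T]%SET.

(* Main.v *)
(* Every class K(x) is a coset of Z, so S is the preimage of the point set of T
   and X is the blow-up of the Cayley graph of F_2^d (d = 2n) on the points of T
   in which every vertex is doubled. Its eigenvalues are 0 and 2 theta_w, where
   theta_w = 2^k m_w - N is the sum of the character chi_w over the points of T
   and m_w counts the members of T on which chi_w is trivial.

   If U(t) e_u = lambda e_v with u != v, then the entry U(t)_(u,u) is zero; its
   real part is (1 + average of cos (2 theta_w t)) / 2, so exp (2 i theta_w t) =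
   -1 for every w. Conversely that condition makes U(t) swap the two vertices of
   each fibre up to sign. At t = pi / 2^(nu+1), nu = nu_2(N) < k, it holds since
   theta_w / 2^nu is an odd integer.

   For minimality put r = 2 t / pi, so that every r theta_w is an odd integer.
   Fourier inversion at a point of T makes b = 2^d r an integer, and w = 0 gives
   b N (2^k - 1) = odd * 2^d; hence nu_2(b) = d - nu and r >= 2^(-nu). *)

Require Import Defs.
From HB Require Import structures.
From mathcomp Require Import all_boot all_order all_fingroup all_algebra.
From mathcomp Require Import all_solvable.
From mathcomp Require Import all_classical all_reals all_analysis.
From mathcomp Require Import complex.
From mathcomp Require Import zify finfield.

Set Implicit Arguments.
Unset Strict Implicit.
Unset Printing Implicit Defensive.

Import Order.TTheory GRing.Theory Num.Theory GroupScope.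
Import numFieldNormedType.Exports.

Local Open Scope ring_scope.

(** * Spectral form of the transition matrix *)

Section ComplexExponential.
Local Open Scope classical_set_scope.
Variable R : realType.
Local Notation toC := (fun x : R => (x%:C)%C : CC R).

Lemma cvg_real_complex (u : nat -> R) (l : R) :
  u @ \oo --> l -> toC (u m) @[m --> \oo] --> toC l.
Proof.
move=> ul; apply/cvgrPdist_lt => e; rewrite ltcE /= => /andP[/eqP Ime Ree].
near=> m.
(* The order on [CC R] makes a positive [e] real, so the radius can be taken in [R]. *)
have -> : e = toC (complex.Re e) by rewrite [LHS]complexE Ime mulr0 addr0.
rewrite -rmorphB /= normc_def /= expr0n /= addr0 sqrtr_sqr ltcR.
by near: m; move/cvgrPdist_lt : ul; apply.
Unshelve. all: by end_near. Qed.

Definition expi (x : R) : CC R := toC (cos x) + 'i * toC (sin x).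

(* Syntactically the summand of [transition_mx], so that it can be folded there. *)
Definition expi_term (x : R) (k : nat) : CC R :=
  (('i * (x%:C)%C) ^+ k / k`!%:R : CC R).

Lemma expi_termM (b : int) (t : R) (k : nat) :
  expi_term t k * b%:~R ^+ k = expi_term (b%:~R * t) k.
Proof.
have toCM : ((b%:~R * t)%:C)%C = b%:~R * (t%:C)%C :> R[i].
  by rewrite rmorphM /= rmorph_int.
by rewrite /expi_term toCM (mulrCA 'i) [in RHS]exprMn [LHS]mulrC mulrA.
Qed.

Lemma expi_termE (x : R) (k : nat) :
  expi_term x k = toC (cos_coeff x k) + 'i * toC (sin_coeff x k).
Proof.
rewrite /expi_term.
rewrite /cos_coeff /sin_coeff /= !rmorphM /= !rmorph_nat !fmorphV /= !rmorph_nat.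
rewrite !rmorphXn /= !rmorphN1 /= exprMn.
(* Parity decides which half survives; at k = 0 the truncated [k.-1] is harmless, as its term has
   coefficient 0. *)
have -> : 'i ^+ k = (~~ odd k)%:R * (-1) ^+ k./2 +
   'i * ((odd k)%:R * (-1) ^+ k.-1./2) :> CC R.
  rewrite -[in LHS](odd_double_half k) exprD -mul2n exprM sqrCi.
  case: (boolP (odd k)) => odk /=; last by rewrite !mul1r mul0r mulr0 addr0.
  rewrite expr1 mul0r add0r mul1r; congr (_ * _ ^+ _).
  by case: k odk => //= k; rewrite uphalf_half => /negPf ->.
by rewrite !mulrDl !mulrA.
Qed.

Lemma cvg_expi (x : R) :
  series (expi_term x) @ \oo --> expi x.
Proof.
have -> : series (expi_term x) =
  (fun m => toC (series (cos_coeff x) m) + 'i * toC (series (sin_coeff x) m)).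
  apply/funext => m; rewrite /series /= !rmorph_sum mulr_sumr -big_split /=.
  by apply: eq_bigr => k _; exact: expi_termE.
apply: cvgD; first apply: cvg_real_complex.
  by rewrite unlock; exact: is_cvg_series_cos_coeff.
apply: cvgM; first exact: cvg_cst.
by apply: cvg_real_complex; rewrite unlock; exact: is_cvg_series_sin_coeff.
Qed.

Lemma expi_eqN1 (x : R) : expi x = -1 <-> cos x = -1.
Proof.
rewrite /expi; split=> [e|cx]; last first.
  have sx : sin x = 0 by apply: cos1sin0; rewrite cx normrN normr1.
  by rewrite cx sx rmorphN1 mulr0 addr0.
apply: complexI.
have re y : toC y \is Num.real by apply/complex_realP; exists y.
rewrite -[LHS](Re_rect (re (cos x)) (re (sin x))) e rmorphN1.
by rewrite (Creal_ReP _ _) // rpredN rpred1.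
Qed.

Lemma expi0 : expi 0 = 1.
Proof. by rewrite /expi cos0 sin0 mulr0 addr0. Qed.

Lemma cosD2pin (x : R) (m : nat) : cos (x + pi *+ 2 *+ m) = cos x.
Proof. by elim: m => [|m IH]; rewrite ?addr0 // mulrSr addrA cosD2pi. Qed.

(** Evenness and removal of full periods bring the forward direction down to [0, 2 pi), where
    injectivity of cosine on [0, pi] applies to y or to 2 pi - y. *)
Lemma cos_eqN1 (x : R) :
  cos x = -1 <-> exists2 m : int, odd `|m|%N & x = pi * m%:~R.
Proof.
have pi0 : 0 < pi :> R := pi_gt0 R.
have cos_odd (m : nat) : odd m -> cos (pi * m%:R) = -1 :> R.
  move=> om; rewrite -(odd_double_half m) om natrD -muln2 natrM mulrDr mulr1.
  by rewrite [_./2%:R * _]mulrC mulrA !mulr_natr cosD2pin cospi.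
split=> [cx|[m om ->]]; last first.
  by case: m om => m om; rewrite ?NegzE ?rmorphN ?mulrN ?cosN; exact: cos_odd.
wlog x0 : x cx / 0 <= x.
  move=> H; case: (lerP 0 x) => [|x0]; first exact: H.
  have [||m om e] := H (- x); rewrite ?cosN ?oppr_ge0 ?ltW //.
  by exists (- m); rewrite ?abszN // rmorphN mulrN -e opprK.
pose q := Num.truncn (x / (pi *+ 2)).
have pi20 : 0 < pi *+ 2 :> R by rewrite pmulrn_lgt0.
have /andP[qx xq] : q%:R <= x / (pi *+ 2) < q.+1%:R.
  by rewrite /q truncn_itv // divr_ge0 // ltW.
move: qx xq; rewrite ler_pdivlMr // ltr_pdivrMr // !mulr_natl => qx xq.
pose y := x - pi *+ 2 *+ q.
have cy : cos y = -1 by rewrite -cx -[in RHS](subrK (pi *+ 2 *+ q) x) cosD2pin.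
have y0 : 0 <= y by rewrite subr_ge0.
have y2 : y < pi *+ 2 by rewrite ltrBlDl -mulrSr.
have piI : pi \in `[(0 : R), pi]%R by rewrite in_itv /= lexx ltW.
have ypi : y = pi.
  have [ley|lty] := lerP y pi.
    have yI : y \in `[(0 : R), pi]%R.
      by rewrite in_itv /= y0 ley.
    by apply: cos_inj yI piI _; rewrite cy cospi.
  have e : pi *+ 2 - y = pi.
    have yI : pi *+ 2 - y \in `[(0 : R), pi]%R.
      by rewrite in_itv /= subr_ge0 ltW //= lerBlDr mulr2n lerD2l ltW.
    by apply: cos_inj yI piI _; rewrite addrC cosD2pi cosN cy cospi.
  by rewrite -[LHS](subKr (pi *+ 2)) e mulr2n addrK.
exists (q.*2.+1)%:Z; first by rewrite /= odd_double.
rewrite -pmulrn mulr_natr mulrSr -muln2 mulnC mulrnA -[X in _ = _ + X]ypi /y.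
by rewrite addrC subrK.
Qed.

End ComplexExponential.

Section SpectralDecomposition.
Local Open Scope classical_set_scope.
Variables (R : realType) (n : nat) (J : finType).
Variables (A : 'M[CC R]_n) (a : J -> int) (E : J -> 'M[CC R]_n).
Hypothesis sumE : \sum_j E j = 1%:M.
Hypothesis AE : forall j, A *m E j = (a j)%:~R *: E j.

Lemma spectral_exp (k : nat) : A ^+ k = \sum_j ((a j)%:~R ^+ k) *: E j.
Proof.
elim: k => [|k IH].
  by rewrite -[LHS]sumE; apply: eq_bigr => j _; rewrite scale1r.
rewrite exprS IH -mulmxE mulmx_sumr; apply: eq_bigr => j _.
by rewrite -scalemxAr AE scalerA exprSr.
Qed.

(** Each power of [A] is a finite combination of the [E j], so the matrix series splits into
    finitely many scalar exponential series with fixed matrix coefficients. *)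
Lemma transition_mx_spectral (t : R) :
  transition_mx A t = \sum_j expi ((a j)%:~R * t) *: E j.
Proof.
rewrite /transition_mx; apply: cvg_lim; first exact: norm_hausdorff.
pose c j := expi_term ((a j)%:~R * t).
have -> : series (fun k => (('i * (t%:C)%C) ^+ k / k`!%:R : CC R) *: A ^+ k) =
    (fun m => \sum_j series (c j) m *: E j).
  apply/funext => m; rewrite /series /=.
  under eq_bigr => k _ do rewrite spectral_exp scaler_sumr.
  rewrite exchange_big; apply: eq_bigr => j _; rewrite scaler_suml.
  apply: eq_bigr => k _; rewrite [LHS]scalerA -/(expi_term t k).
  by rewrite expi_termM.
have cvgE j : series (c j) m *: E j @[m --> \oo] --> expi ((a j)%:~R * t) *: E j.
  by apply: cvgZr_tmp; exact: cvg_expi.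
elim: (index_enum J) => [|j s IHs].
  under eq_fun do rewrite big_nil.
  by rewrite big_nil; exact: cvg_cst.
under eq_fun do rewrite big_cons.
by rewrite big_cons; apply: cvgD (cvgE j) IHs.
Qed.

End SpectralDecomposition.

(** * Characters of F_2^d and partial spreads *)

Section BinaryCharacters.
Variable d : nat.
Implicit Types (u v w : 'rV['F_2]_d) (U : {vspace 'rV['F_2]_d}).

Lemma addvv2 v : v + v = 0.
Proof.
apply/rowP => i; rewrite !mxE.
by case: (v 0 i) => [[|[|m]] lt_m] //; apply/val_inj.
Qed.

Lemma oppv2 v : - v = v.
Proof. by apply/eqP; rewrite eq_sym -addr_eq0 addvv2. Qed.

(** The additive character of F_2^d attached to w, with integer values so that parity and 2-adic
    valuations of its sums make sense. *)
Definition chi w v : int := (-1) ^+ ((w *m v^T) 0 0 != 0).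

Lemma chiD w u v : chi w (u + v) = chi w u * chi w v.
Proof.
rewrite /chi linearD mulmxDr mxE -signr_addb; congr (_ ^+ nat_of_bool _).
by move: ((w *m u^T) 0 0) ((w *m v^T) 0 0) => [[|[|a]] ?] [[|[|b]] ?].
Qed.

Lemma chiC w v : chi w v = chi v w.
Proof. by rewrite /chi -[w in LHS]trmxK -trmx_mul mxE. Qed.

Lemma chi0 w : chi w 0 = 1.
Proof. by rewrite /chi linear0 mulmx0 mxE eqxx. Qed.

Lemma chi_eq1 w v : (chi w v == 1) = (chi w v != -1).
Proof. by rewrite /chi; case: (_ != 0). Qed.

(** If the character is -1 at some u in [U], translation by u negates the sum, which is then
    zero. *)
Lemma sum_chi_subspace w U :
  \sum_(v in U) chi w v = (if [forall v in U, chi w v == 1] then #|U| else 0)%N.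
Proof.
case: forall_inP => [all1 | nall1].
  by rewrite (eq_bigr (fun=> 1)) => [|v /all1/eqP //]; rewrite sumr_const natz.
have [u Uu /eqP xu] : exists2 u, u \in U & chi w u == -1.
  apply/exists_inP; apply: contraT => /exists_inPn nu; case: nall1 => v Uv.
  by rewrite chi_eq1; apply: nu.
suff: \sum_(v in U) chi w v = - \sum_(v in U) chi w v by lia.
rewrite -sumrN [LHS](reindex_inj (addIr u)) /=.
by apply: eq_big => v; [exact: rpredDr | rewrite chiD xu mulrN1].
Qed.

Lemma card_subspace2 U : #|U| = (2 ^ \dim U)%N.
Proof. by rewrite card_vspace card_Fp. Qed.

Lemma sum_chi v : \sum_w chi w v = 2 ^+ d * (v == 0)%:R.
Proof.
under eq_bigr do rewrite chiC.
have -> : \sum_w chi v w = \sum_(w in @fullv _ 'rV['F_2]_d) chi v w.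
  by apply: eq_bigl => w; rewrite memvf.
rewrite sum_chi_subspace card_subspace2 dimvf /dim /= mul1n.
have [-> | v0] := eqVneq v 0.
  case: forall_inP => [_|[]]; last by move=> w _; rewrite chiC chi0.
  by rewrite mulr1 -natz natrX.
case: forall_inP => [all1|_]; last by rewrite mulr0.
have /existsP[i vi] : [exists i, v 0 i != 0].
  apply: contraNT v0 => /existsPn v0; apply/eqP/rowP => i.
  by rewrite mxE; have /negPn/eqP := v0 i.
have /= := all1 (delta_mx 0 i) (memvf _).
by rewrite /chi trmx_delta -colE mxE vi.
Qed.

End BinaryCharacters.

Section SpreadCharacterSums.
Variables (d k : nat) (T : seq {vspace 'rV['F_2]_d}).
Hypothesis Tspread : partial_spread k T.

(** Distinct members share only the zero vector, so a nonzero vector lies in at most one. *)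
Lemma spread_count v : v != 0 ->
  count (fun U : {vspace 'rV['F_2]_d} => v \in U) T =
  has (fun U : {vspace _} => v \in U) T.
Proof.
have [uT _ dT] := Tspread; move=> v0.
have [/hasP[U TU Uv] | nT] := boolP (has _ T); last first.
  by apply/eqP; rewrite -leqn0 leqNgt -has_count.
rewrite (@eq_in_count _ _ (pred1 U)) => [|W TW]; first by rewrite count_uniq_mem // TU.
apply/idP/eqP => [Wv|-> //]; apply/eqP; apply: contraNT v0 => neqWU.
by rewrite -memv0 -(dT _ _ TW TU neqWU) memv_cap Wv.
Qed.

(** Each point lies in exactly one member, so the sum can be taken member by member: each gives its
    whole subspace sum, 2^k or 0, less the value 1 at zero. *)
Lemma spread_chi_sum w :
  \sum_(p in spread_points T) chi w p =
  2 ^+ k * (count (fun U : {vspace 'rV['F_2]_d} => [forall v in U, chi w v == 1]) T)%:Z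
    - (size T)%:Z.
Proof.
have [_ dimT _] := Tspread.
have -> : \sum_(p in spread_points T) chi w p =
    \sum_(U <- T) (\sum_(v in U) chi w v - 1).
  transitivity (\sum_(v | v != 0) \sum_(U <- T | v \in U) chi w v).
    rewrite big_mkcond [RHS]big_mkcond; apply: eq_bigr => v _; rewrite inE.
    have [//|v0 /=] := eqVneq v 0.
    rewrite big_const_seq spread_count //.
    by case: (has _ T); rewrite /= ?addr0.
  rewrite (exchange_big_dep predT) //=; apply: eq_bigr => U _.
  rewrite [in RHS](bigD1 0) ?mem0v //= chi0 addrC addrK.
  by apply: eq_bigl => v; rewrite andbC.
transitivity (\sum_(U <- T)
    (2 ^+ k * [forall v in U, chi w v == 1]%:Z - 1)).
  apply: eq_big_seq => U /dimT dU; rewrite sum_chi_subspace card_subspace2 dU.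
  by case: ifP => _; rewrite ?mulr0 // mulr1 -natz natrX.
rewrite sumrB -mulr_sumr; congr (_ * _ - _); rewrite -natz.
  rewrite -sum1_count natr_sum [RHS]big_mkcond /=.
  by apply: eq_bigr => U _; case: ifP.
by rewrite -sum1_size natr_sum.
Qed.

End SpreadCharacterSums.

(** * Doubled Cayley graphs of F_2^d *)

Lemma big_option (M : nmodType) (I : finType) (F : option I -> M) :
  \sum_j F j = F None + \sum_i F (Some i).
Proof.
rewrite (bigD1 None) //=; congr (_ + _).
rewrite (reindex_omap Some id) => [|[]] //=.
by apply: eq_bigl => i; rewrite eqxx.
Qed.

Section BlowUp.
Variables (R : realType) (d : nat) (V : finType) (e : rel V).
Variables (phi : V -> 'rV['F_2]_d) (P : {set 'rV['F_2]_d}).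
Hypothesis fibre2 : forall x, #|[set g | phi g == x]%SET| = 2%N.
Hypothesis eE : forall g h, e g h = (phi g - phi h \in P).

Local Notation theta w := (\sum_(p in P) chi w p).

Lemma sum_fibres (M : nmodType) (F : 'rV['F_2]_d -> M) :
  \sum_(i < #|V|) F (phi (enum_val i)) = \sum_x F x *+ 2.
Proof.
transitivity (\sum_(g : V) F (phi g)).
  rewrite [RHS](reindex_onto enum_val enum_rank) => [|g _]; last exact: enum_rankK.
  by apply: eq_bigl => i; rewrite enum_valK eqxx.
rewrite (partition_big phi predT) //=; apply: eq_bigr => x _.
rewrite (eq_bigr (fun=> F x)) => [|g /eqP-> //].
rewrite sumr_const; congr (_ *+ _); rewrite -[RHS](fibre2 x).
by apply: eq_card => g; rewrite inE.
Qed.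

(** The rank-one projection onto the lift of the character w along [phi]; the scalar is 1/|V|, since
    all fibres have two elements. *)
Definition char_mx (w : 'rV['F_2]_d) : 'M[CC R]_#|V| :=
  (2 ^- d.+1 : CC R) *:
    \matrix_(i, j) (chi w (phi (enum_val i) - phi (enum_val j)))%:~R.

(* The index [None] is the kernel component, spanned by the differences of the
   two vertices of a fibre. *)
Definition spectral_mx (j : option 'rV['F_2]_d) : 'M[CC R]_#|V| :=
  if j is Some w then char_mx w else 1%:M - \sum_w char_mx w.

Definition spectral_val (j : option 'rV['F_2]_d) : int :=
  if j is Some w then 2 * theta w else 0.

(** By orthogonality of characters, the sum of the projections averages over each fibre. *)
Lemma sum_char_mxE i j : (\sum_w char_mx w) i j =
  2^-1 * (phi (enum_val i) == phi (enum_val j))%:R :> CC R.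
Proof.
rewrite summxE; under eq_bigr do rewrite !mxE.
rewrite -mulr_sumr -rmorph_sum sum_chi subr_eq0 rmorphM rmorphXn /= mulrA.
rewrite rmorph_nat; congr (_ * _); last exact: rmorph_nat.
by rewrite exprS invfM -mulrA mulVf ?mulr1 ?expf_neq0 ?pnatr_eq0.
Qed.

Lemma sum_spectral_mx : \sum_j spectral_mx j = 1%:M.
Proof. by rewrite big_option /= subrK. Qed.

Lemma adj_char_mx w :
  adjmx R e *m char_mx w = (2 * theta w)%:~R *: char_mx w.
Proof.
rewrite /char_mx -scalemxAr scalerA mulrC -scalerA; congr (_ *: _).
apply/matrixP => i j; rewrite !mxE.
pose F x : CC R := (phi (enum_val i) - x \in P)%:R * (chi w (x - phi (enum_val j)))%:~R.
transitivity (\sum_(l < #|V|) F (phi (enum_val l))).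
  by apply: eq_bigr => l _; rewrite !mxE eE.
rewrite sum_fibres sumrMnl -[LHS]mulr_natl rmorphM /= -mulrA; congr (_ * _).
(* Substituting x = phi i + p turns neighbours into points p of [P]. *)
rewrite (reindex_inj (addrI (phi (enum_val i)))) /= rmorph_sum mulr_suml.
rewrite [RHS]big_mkcond; apply: eq_bigr => p _; rewrite /F.
rewrite opprD addrA subrr add0r !oppv2.
case: (p \in P); rewrite ?mul0r // mul1r /=.
by rewrite -rmorphM -chiD addrCA addrA.
Qed.

(** Rows of the adjacency matrix are constant on fibres, so averaging over fibres changes nothing;
    hence the complementary projection is killed. *)
Lemma adj_twin :
  adjmx R e *m (\sum_w char_mx w) = adjmx R e.
Proof.
apply/matrixP => i j; rewrite !mxE.
pose F x : CC R := (phi (enum_val i) - x \in P)%:R * (2^-1 * (x == phi (enum_val j))%:R).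
transitivity (\sum_(l < #|V|) F (phi (enum_val l))).
  by apply: eq_bigr => l _; rewrite sum_char_mxE !mxE eE.
rewrite sum_fibres (bigD1 (phi (enum_val j))) //= big1 => [|x /negPf nx]; last first.
  by rewrite /F nx !mulr0 mul0rn.
by rewrite /F eqxx mulr1 addr0 eE -mulrnAr -[2^-1 *+ 2]mulr_natr mulVf ?mulr1 ?pnatr_eq0.
Qed.

Lemma adj_spectral_mx j :
  adjmx R e *m spectral_mx j = (spectral_val j)%:~R *: spectral_mx j.
Proof.
case: j => [w|] /=; first exact: adj_char_mx.
by rewrite mulmxBr mulmx1 adj_twin subrr scale0r.
Qed.

Lemma transition_blowupE t i j :
  transition_mx (adjmx R e) t i j =
  (i == j)%:R - 2^-1 * (phi (enum_val i) == phi (enum_val j))%:R +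
  2 ^- d.+1 * \sum_w expi ((2 * theta w)%:~R * t) *
    (chi w (phi (enum_val i) - phi (enum_val j)))%:~R.
Proof.
rewrite (transition_mx_spectral sum_spectral_mx adj_spectral_mx) big_option /=.
rewrite mul0r expi0 scale1r !mxE sum_char_mxE.
rewrite summxE mulr_sumr; congr (_ - _ + _); apply: eq_bigr => w _.
by rewrite !mxE mulrCA.
Qed.

Lemma pst_blowup t :
  perfect_state_transfer e t <->
  0 < t /\ forall w, cos ((2 * theta w)%:~R * t) = -1 :> R.
Proof.
split=> [[t0 [u [v [neq_uv [lam /colP/(_ u)]]]]]|[t0 cosN1]].
  rewrite -colE !mxE /= (negPf neq_uv) mulr0 transition_blowupE !eqxx !subrr => U0.
  split=> //.
  pose x w : R := (2 * theta w)%:~R * t.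
  have re y : (y%:C)%C \is @Num.real (CC R) by apply/complex_realP; exists y.
  have sum_cos : \sum_w (cos (x w) + 1) = 0.
    have : \sum_w expi (x w) = - 2 ^+ d.
      apply: (mulfI (_ : 2 ^- d.+1 != 0 :> CC R)); first by
        rewrite invr_eq0 expf_neq0 ?pnatr_eq0.
      move: U0; under eq_bigr do rewrite chi0 mulr1.
      rewrite mulr1 (_ : 1 - 2^-1 = 2^-1); last by rewrite [X in X - _]splitr mul1r addrK.
      rewrite addrC => /eqP; rewrite addr_eq0 => /eqP ->.
      by rewrite mulrN exprS invfM mulfVK ?expf_neq0 ?pnatr_eq0.
    rewrite /expi big_split /= -mulr_sumr -!rmorph_sum.
    move=> /(congr1 (fun z : CC R => 'Re z)).
    have reN : 'Re (- 2 ^+ d : CC R) = - 2 ^+ d.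
      by apply/Creal_ReP; rewrite rpredN rpredX ?realn.
    rewrite reN (Re_rect (re _) (re _)) => sum_re.
    rewrite big_split /= sumr_const card_mx card_Fp // mul1n natrX.
    apply: complexI; rewrite rmorphD /= sum_re rmorphXn rmorph_nat /=; exact: addNr.
  have nneg w : true -> 0 <= cos (x w) + 1.
    by move=> _; rewrite -lerBlDr sub0r cos_geN1.
  move=> w; apply/eqP; rewrite -addr_eq0; apply/eqP.
  by apply: (psumr_eq0P nneg sum_cos).
split=> //.
(* The fibre over 0 supplies the pair of vertices; transfer between them has phase -1. *)
have /cards2P [g [h [neq_gh fib]]] := introT eqP (fibre2 0).
have phiE y : phi y == 0 = (y \in [set g; h]) by rewrite -fib inE.
exists (enum_rank g), (enum_rank h); split; first by rewrite (inj_eq enum_rank_inj).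
exists (-1); apply/colP => i; rewrite -!colE !mxE transition_blowupE.
rewrite -(enum_valK i) !enum_rankK !(inj_eq enum_rank_inj) andbT; move: (enum_val i) => y.
(* With all exponentials equal to -1, orthogonality makes U(t) the identity minus the same-fibre
   indicator. *)
under eq_bigr => w _ do rewrite (proj2 (expi_eqN1 _) (cosN1 w)) mulN1r.
have /eqP pg : phi g == 0 by rewrite phiE !inE eqxx.
rewrite sumrN -rmorph_sum sum_chi pg !subr0 phiE !inE rmorphM rmorphXn rmorph_nat.
rewrite mulrN mulrA exprS invfM mulfVK ?expf_neq0 ?pnatr_eq0 //= rmorph_nat.
rewrite -addrA -opprD -mulrDl -div1r -splitr mul1r.
have [-> | _] := eqVneq y g; first by rewrite (negPf neq_gh) subrr mulr0.
by rewrite sub0r mulN1r.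
Qed.

End BlowUp.

(** * Connectedness of the blow-up *)

Section Connectivity.
Variables (d : nat) (V : finType) (e : rel V).
Variables (phi : V -> 'rV['F_2]_d) (P : {set 'rV['F_2]_d}).
Hypothesis fibre2 : forall x, #|[set g | phi g == x]%SET| = 2%N.
Hypothesis eE : forall g h, e g h = (phi g - phi h \in P).

Lemma phi_surj x : exists g, phi g = x.
Proof.
have /card_gt0P[g] : (0 < #|[set g | phi g == x]%SET|)%N by rewrite fibre2.
by rewrite inE => /eqP; exists g.
Qed.

Lemma connected_blowup p0 :
  0 \notin P -> p0 \in P -> span (enum P) = fullv -> connected_graph e.
Proof.
move=> P0 Pp0 spanP; split=> [g h|g|].
- by rewrite !eE !oppv2 addrC.
- by rewrite eE subrr; apply/negbTE.
(* The x for which all vertices with images differing by x are joined by a path; they will form a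
   subspace containing [P]. *)
pose Q x := forall g h, phi g = phi h + x -> connect e g h.
have QP x : x \in P -> Q x.
  by move=> Px g h gh; apply: connect1; rewrite eE gh addrC addKr.
have QD x y : Q x -> Q y -> Q (x + y).
  move=> Qx Qy g h gh; have [l lh] := phi_surj (phi h + y).
  by apply: (connect_trans (Qx g l _) (Qy l h lh)); rewrite lh gh addrAC addrA.
(* Twin vertices are not adjacent; a path between them goes along [p0] and back. *)
have Q0 : Q 0 by rewrite -(addvv2 p0); apply: QD; apply: QP.
have Qspan x : x \in span (enum P) -> Q x.
  move=> /(@coord_span _ _ _ (in_tuple (enum P))) ->.
  apply: (big_ind Q) => // i _.
  have : (in_tuple (enum P))`_i \in P.
    by rewrite -mem_enum; apply: mem_nth; exact: ltn_ord.
  move: (coord _ _ _) ((in_tuple _)`_i) => [[|[|c]] ltc] // p Pp.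
    by rewrite (_ : Ordinal ltc = 0) ?scale0r //; apply/val_inj.
  by rewrite (_ : Ordinal ltc = 1) ?scale1r; [apply: QP | apply/val_inj].
move=> g h; apply: (Qspan (phi g - phi h)); first by rewrite spanP memvf.
by rewrite addrC subrK.
Qed.

End Connectivity.

(** * The transfer time: attainment and minimality *)

Section MinimumTime.
Variables (R : realType) (d k : nat) (T : seq {vspace 'rV['F_2]_d}).
Hypotheses (Tspread : partial_spread k T) (k_gt0 : (0 < k)%N) (T_gt0 : (0 < size T)%N).

Local Notation theta w := (\sum_(p in spread_points T) chi w p).
Local Notation nu := (logn 2 (size T)).

Lemma spread_point_exists : exists p, p \in spread_points T.
Proof.
have [_ dimT _] := Tspread.
case: T dimT T_gt0 => // U T' dimT _; have dU := dimT U (mem_head U T').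
exists (vpick U); rewrite inE vpick0 -dimv_eq0 dU -lt0n k_gt0 /=.
by apply/orP; left; exact: memv_pick.
Qed.

Lemma spread_chi_sum0 : theta 0 = (size T * (2 ^ k - 1))%N.
Proof.
rewrite (spread_chi_sum Tspread) (eq_count (a2 := predT)) => [|U /=].
  by rewrite count_predT -!natz natrM natrB ?expn_gt0 // natrX mulrBr mulr1 mulrC.
by apply/forall_inP => v _; rewrite chiC chi0.
Qed.

(** Fourier inversion: the [theta] values are the Fourier coefficients of the indicator of the point
    set, which is 1 at [p0]. *)
Lemma sum_theta_chi p0 : p0 \in spread_points T ->
  \sum_w theta w * chi w p0 = 2 ^+ d.
Proof.
move=> Pp0; under eq_bigr do rewrite mulr_suml.
rewrite exchange_big /= (bigD1 p0) //= [X in _ + X]big1 => [|p /andP[_ np]].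
  by under eq_bigr do rewrite -chiD; rewrite sum_chi addvv2 eqxx mulr1 addr0.
under eq_bigr do rewrite -chiD.
by rewrite sum_chi addr_eq0 oppv2 (negPf np) mulr0.
Qed.

Lemma cos_theta w : (nu <= k - 1)%N ->
  cos ((2 * theta w)%:~R * (pi / 2 ^+ nu.+1)) = -1 :> R.
Proof.
move=> val_T; apply/cos_eqN1.
set m := count (fun U : {vspace 'rV['F_2]_d} => [forall v in U, chi w v == 1]) T.
have [q oddq defN] : exists2 q, odd q & size T = (q * 2 ^ nu)%N.
  by have [q] := pfactor_coprime (isT : prime 2) T_gt0; rewrite coprime2n; exists q.
(* As k > 0, the truncated bound means nu < k; the successor form exposes a factor 2. *)
have defk : k = (nu + (k - nu).-1.+1)%N by lia.
set l := (k - nu).-1 in defk.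
(* This is theta / 2^nu, an even number minus the odd part of [size T]. *)
pose z : int := 2 ^+ l.+1 * m%:Z - q%:Z.
have sizeE : (size T)%:Z = 2 ^+ nu * q%:Z.
  by rewrite {1}defN PoszM mulrC -[(2 ^ nu)%N%:Z]natz natrX.
have thetaE : theta w = 2 ^+ nu * z.
  by rewrite (spread_chi_sum Tspread) -/m sizeE /z mulrBr mulrA -exprD -defk.
exists z.
  rewrite /z exprS -mulrA; move: (2 ^+ l * m%:Z) => y; lia.
rewrite thetaE mulrA -exprS rmorphM rmorphXn /= mulrC -mulrA; congr (_ * _).
by rewrite mulKf // expf_neq0 // pnatr_eq0.
Qed.

Lemma min_time (t : R) :
  0 < t -> (forall w, cos ((2 * theta w)%:~R * t) = -1) -> pi / 2 ^+ nu.+1 <= t.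
Proof.
move=> t0 cosN1; have pi0 := pi_gt0 R.
have [c c_odd cE] : exists2 c : 'rV['F_2]_d -> int, (forall w, odd `|c w|%N) &
    (forall w, (2 * theta w)%:~R * t = pi * (c w)%:~R).
  have H w : exists m : int, odd `|m|%N /\ (2 * theta w)%:~R * t = pi * m%:~R.
    by have /cos_eqN1[m] := cosN1 w; exists m.
  by have [c cP] := choice H; exists c; move=> w; case: (cP w).
have [p0 Pp0] := spread_point_exists.
(* By Fourier inversion at a point p0 of T, 2^(d+1) t / pi is an integer. *)
pose b := \sum_w c w * chi w p0.
have bE : pi * b%:~R = 2 ^+ d.+1 * t.
  rewrite rmorph_sum mulr_sumr.
  under eq_bigr => w _ do rewrite rmorphM /= mulrA -cE mulrAC -rmorphM.
  rewrite -mulr_suml -rmorph_sum; congr (_ * _).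
  under eq_bigr do rewrite -mulrA.
  by rewrite -mulr_sumr sum_theta_chi // -exprS rmorphXn.
have b0 : 0 < b by rewrite -(ltr0z R) -(pmulr_rgt0 _ pi0) bE mulr_gt0 ?exprn_gt0.
(* The case w = 0 of [cE], with t eliminated by [bE]. *)
have key : b * theta 0 = c 0 * 2 ^+ d.
  apply: (@intr_inj R); apply: (mulfI (lt0r_neq0 pi0)).
  rewrite !rmorphM /= !mulrA bE -cE rmorphM rmorphXn /= exprS.
  rewrite -!mulrA; congr (_ * _). rewrite mulrA [LHS]mulrC; congr (_ * _); exact: mulrC.
(* Positivity makes [b] a natural number, so [logn] applies. *)
case: b b0 bE key => // b b0 bE.
rewrite spread_chi_sum0 => /(congr1 absz); rewrite abszM /= abszM abszX /= => key.
have b0' : (0 < b)%N by [].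
have odd_gt0 x : odd x -> (0 < x)%N by case: x.
have logn_odd x : odd x -> logn 2 x = 0%N.
  by move=> ox; rewrite logn_coprime // coprime2n.
have odd2k : odd (2 ^ k - 1).
  case: k k_gt0 => // l _.
  by rewrite expnS mul2n oddB ?odd_double // double_gt0 expn_gt0.
(* Both 2^k - 1 and [c 0] are odd, so [key] compares powers of 2 only. *)
have vb : (logn 2 b + nu)%N = d.
  have := congr1 (logn 2) key.
  rewrite !lognM ?expn_gt0 ?muln_gt0 ?T_gt0 ?(odd_gt0 _ odd2k) ?(odd_gt0 _ (c_odd 0)) //.
  rewrite -[(1 + 1)%N]/2%N.
  by rewrite (logn_odd _ odd2k) (logn_odd _ (c_odd 0)) addn0 add0n pfactorK.
have tE : t = pi * b%:R / 2 ^+ d.+1.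
  by rewrite -[b%:R]/(b%:Z%:~R) bE mulrAC mulfV ?mul1r // expf_neq0 // pnatr_eq0.
have dS : 2 ^+ d.+1 = 2 ^+ nu.+1 * 2 ^+ logn 2 b :> R.
  by rewrite -exprD addSn addnC vb.
rewrite tE ler_pdivlMr ?exprn_gt0 // dS mulrA mulfVK ?expf_neq0 ?pnatr_eq0 //.
(* It remains that the 2-part of [b] is at most [b]. *)
rewrite ler_pM2l // -natrX ler_nat.
by apply: dvdn_leq => //; apply: pfactor_dvdnn.
Qed.

End MinimumTime.

(** * Extraspecial groups *)

Section ExtraspecialClasses.
Variables (gT : finGroupType) (G : {group gT}).
Hypotheses (G2 : 2.-group G) (Ges : extraspecial G).

(** A conjugate of x is x times a commutator, hence in the coset because G' = Z; a noncentral class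
    has more than one element and the coset only two. *)
Lemma class_extraspecial x : x \in G -> x \notin 'Z(G) -> x ^: G = (x *: 'Z(G))%g.
Proof.
move=> Gx nZx; have [[_ defG'] _] := Ges.
apply/eqP; rewrite eqEcard; apply/andP; split.
  apply/fintype.subsetP => _ /imsetP[g Gg ->].
  by rewrite conjg_mulR mem_lcoset mulKg -defG' mem_commg.
rewrite card_lcoset (card_center_extraspecial G2 Ges) ltnNge.
apply: contra nZx => le1; rewrite inE Gx /=; apply/cent_classP.
by apply/eqP; rewrite eq_sym eqEcard cards1 le1 finset.sub1set class_refl.
Qed.

(** Noncentral classes are full cosets of the centre, so membership in their union depends only on
    the image in the central quotient. *)
Lemma mem_classes_coset (xs : seq gT) x s :
    {subset xs <= G} -> {in xs, forall y, y \notin 'Z(G)} ->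
    s \in (\bigcup_(y <- xs) y ^: G)%SET -> x \in (s *: 'Z(G))%g ->
  x \in (\bigcup_(y <- xs) y ^: G)%SET.
Proof.
move=> xsG xsZ; rewrite !finset.bigcup_seq => /finset.bigcupP[y xs_y ys] sx.
apply/finset.bigcupP; exists y => //.
have [Gy nZy] := (xsG y xs_y, xsZ y xs_y).
move: ys; rewrite class_extraspecial // => ys.
by rewrite -(lcoset_eqP ys).
Qed.

End ExtraspecialClasses.

Section CentralQuotient.
Variables (gT : finGroupType) (G : {group gT}) (d : nat).
Variable f : {morphism (G / 'Z(G))%g >-> 'rV['F_2]_d}.
Hypotheses (G2 : 2.-group G) (Ges : extraspecial G).
Hypothesis fiso : isom (G / 'Z(G))%g [set: 'rV['F_2]_d]%SET f.

Definition central_vec (x : gT) : 'rV['F_2]_d := f (coset 'Z(G) x).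

Let nZ x : x \in G -> x \in 'N('Z(G)).
Proof. exact: (fintype.subsetP (normal_norm (center_normal G))). Qed.

Lemma central_vecB x y : x \in G -> y \in G ->
  central_vec (x * y^-1)%g = central_vec x - central_vec y.
Proof.
move=> Gx Gy; rewrite /central_vec morphM ?morphV ?groupV ?nZ //.
by rewrite morphM ?morphV ?groupV ?mem_quotient.
Qed.

Lemma central_vec_eq x y : x \in G -> y \in G ->
  (central_vec x == central_vec y) = (x \in y *: 'Z(G))%g.
Proof.
move=> Gx Gy; have [injf _] := isomP fiso.
rewrite /central_vec (inj_in_eq (injmP injf)) ?mem_quotient //.
by rewrite -norm_rlcoset ?nZ //; apply/eqP/rcoset_kercosetP; rewrite ?nZ.
Qed.

Lemma central_vec_surj v : exists2 x, x \in G & central_vec x = v.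
Proof.
have [_ imf] := isomP fiso.
have : v \in f @* (G / 'Z(G)) by rewrite imf inE.
case/morphimP => _ _ /morphimP[x _ Gx ->] ->; by exists x.
Qed.

Lemma card_central_fibre v :
  #|[set g : subg_of G | central_vec (sgval g) == v]%SET| = 2%N.
Proof.
have [x Gx <-] := central_vec_surj v.
transitivity #|(x *: 'Z(G))%g|; last first.
  by rewrite card_lcoset; exact: card_center_extraspecial.
rewrite -(card_imset _ (@val_inj _ _ (subg_of G))); apply: eq_card => y.
apply/imsetP/idP => [[g] | xy].
  by rewrite inE central_vec_eq ?subgP // => gx ->.
have Gy : y \in G.
  by case/lcosetP: xy => z /(fintype.subsetP (center_sub G)) Gz ->; rewrite groupM.
by exists (subg G y); rewrite ?inE subgK ?central_vec_eq.
Qed.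

(** Within [G], [S] is the full preimage of [P], so adjacency can be read off in the quotient, as
    the blow-up setting demands. *)
Lemma cayley_central (xs : seq gT) (P : {set 'rV['F_2]_d}) (S : {set gT}) g h :
    {subset xs <= G} -> {in xs, forall x, x \notin 'Z(G)} ->
    S = (\bigcup_(x <- xs) x ^: G)%SET -> [set central_vec x | x in S]%SET = P ->
  @cayley gT G S g h = (central_vec (sgval g) - central_vec (sgval h) \in P).
Proof.
move=> xsG xsZ defS <-.
have sSG s : s \in S -> s \in G.
  rewrite defS finset.bigcup_seq => /finset.bigcupP[y xs_y].
  by apply: fintype.subsetP; rewrite class_subG ?xsG.
rewrite -central_vecB ?subgP // /cayley.
have: (sgval g * (sgval h)^-1)%g \in G by rewrite groupM ?groupV ?subgP.
move: (_ * _)%g => x Gx; apply/idP/imsetP => [Sx | [s Ss /eqP]]; first by exists x.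
rewrite central_vec_eq ?(sSG s) // => sx.
by rewrite defS; apply: (mem_classes_coset G2 Ges xsG xsZ _ sx); rewrite -defS.
Qed.

End CentralQuotient.

(** * Assembly: spanning spreads and the final theorem *)

(** Two distinct members meet trivially, so their sum has dimension 2k and already fills the
    space. *)
Lemma spread_points_span (d k : nat) (T : seq {vspace 'rV['F_2]_d}) :
    partial_spread k T -> (d <= k + k)%N -> (1 < size T)%N ->
  span (enum (spread_points T)) = fullv.
Proof.
move=> [uT dimT dT] le_d_2k T_gt1.
have subT U : U \in T -> (U <= span (enum (spread_points T)))%VS.
  move=> TU; apply/subvP => v Uv; have [-> | v0] := eqVneq v 0; first exact: mem0v.
  by apply: memv_span; rewrite mem_enum inE v0; apply/hasP; exists U.
case: T uT dimT dT T_gt1 subT => [|U [|W T]] // /andP[nUW _] dimT dT _ subT.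
have [TU TW] : U \in [:: U, W & T] /\ W \in [:: U, W & T] by rewrite !inE !eqxx orbT.
have neqUW : U != W by apply: contraNneq nUW => ->; rewrite mem_head.
apply/eqP; rewrite eqEdim subvf dimvf /dim /= mul1n.
apply: leq_trans (dimvS (_ : U + W <= _)%VS); last by rewrite subv_add !subT.
by rewrite dimv_disjoint_sum ?(dT _ _ TU TW) // !dimT.
Qed.

Lemma spread_pst (R : realType) (d k : nat) (V : finType) (e : rel V)
    (phi : V -> 'rV['F_2]_d) (T : seq {vspace 'rV['F_2]_d}) :
    (forall x, #|[set g | phi g == x]%SET| = 2%N) ->
    (forall g h, e g h = (phi g - phi h \in spread_points T)) ->
    partial_spread k T -> (0 < d)%N ->
    span (enum (spread_points T)) = fullv -> (logn 2 (size T) <= k - 1)%N ->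
  connected_graph e /\ pst_minimum_time e (pi / 2 ^+ logn 2 (2 * size T) : R).
Proof.
move=> fibre2 eE Tspread d_gt0 spanT val_T.
(* The points span a space of positive dimension, so one exists; it forces both [size T] and [k] to
   be positive. *)
have [p0 Pp0] : exists p, p \in spread_points T.
  apply/set0Pn; apply: contraTneq d_gt0 => P0.
  move: spanT; rewrite P0 enum_set0 span_nil => /(congr1 (fun U => \dim U)).
  by rewrite dimv0 dimvf /dim /= mul1n => <-.
have [T_gt0 k_gt0] : (0 < size T)%N /\ (0 < k)%N.
  move: Pp0; rewrite inE => /andP[p0n0 /hasP[U TU Up0]]; split.
    by rewrite -has_predT; apply/hasP; exists U.
  have [_ dimT _] := Tspread; rewrite -(dimT U TU) lt0n dimv_eq0.
  by apply: contraNneq p0n0 => U0; rewrite -memv0 -U0.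
split; first by apply: (connected_blowup fibre2 eE _ Pp0 spanT); rewrite inE eqxx.
rewrite lognM // logn_prime // add1n; split.
  apply/(pst_blowup fibre2 eE); split; last first.
    by move=> w; exact: (cos_theta R Tspread k_gt0 T_gt0 w val_T).
  by rewrite divr_gt0 ?pi_gt0 ?exprn_gt0.
by move=> s /(pst_blowup fibre2 eE)[s_gt0 cosN1]; apply: (min_time Tspread).
Qed.

Theorem theorem4p10 (R : realType) (gT : finGroupType) (G : {group gT})
    (n k N : nat)
    (f : {morphism (G / 'Z(G))%g >-> 'rV['F_2]_(2 * n)})
    (T : seq {vspace 'rV['F_2]_(2 * n)})
    (xs : seq gT) (S : {set gT})
    (G2 : 2.-group G) (Ges : extraspecial G)
    (oG : #|G| = (2 ^ (2 * n).+1)%N)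
    (fiso : isom (G / 'Z(G))%g [set: 'rV['F_2]_(2 * n)]%SET f)
    (Tspread : partial_spread k T) (TN : size T = N)
    (xsG : {subset xs <= G})
    (xsZ : {in xs, forall x, x \notin 'Z(G)})
    (xsK : uniq [seq x ^: G | x <- xs])
    (defS : S = (\bigcup_(x <- xs) x ^: G)%SET)
    (SbarT : [set f (coset 'Z(G) x) | x in S]%SET = spread_points T) :
  (span (enum (spread_points T)) = fullv ->
   (logn 2 N <= k - 1)%N ->
   connected_graph (@cayley gT G S) /\
   pst_minimum_time (@cayley gT G S) (pi / 2 ^+ logn 2 (2 * N) : R))
  /\
  (k = n -> (2 <= n)%N -> N = (2 ^ (n - 1))%N ->
   connected_graph (@cayley gT G S) /\
   pst_minimum_time (@cayley gT G S) (pi / 2 ^+ n : R)).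
Proof.
(* For n = 0 the group would have order 2 and equal its centre. *)
have d_gt0 : (0 < 2 * n)%N.
  rewrite lt0n; apply: contraNneq (extraspecial_nonabelian Ges) => n0.
  have /eqP <- // : 'Z(G) == G :> {set gT}; last exact: center_abelian.
  by rewrite eqEcard center_sub oG n0 (card_center_extraspecial G2 Ges).
have fibre2 := card_central_fibre G2 Ges fiso.
have eE g h := cayley_central G2 Ges fiso g h xsG xsZ defS SbarT.
have main := spread_pst R fibre2 eE Tspread d_gt0.
rewrite -TN; split=> // kn n_ge2 NE.
have szT : size T = (2 ^ (n - 1))%N by [].
have nE : logn 2 (2 * size T) = n by rewrite szT -expnS pfactorK //; lia.
rewrite -[X in pi / 2 ^+ X]nE.
apply: main; last by rewrite szT pfactorK // kn.
(* Two members of dimension n suffice to span, and [2 <= n] provides them. *)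
apply: (spread_points_span Tspread); first by rewrite kn mul2n addnn.
by rewrite szT -[1%N](expn0 2) ltn_exp2l //; lia.
Qed.
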